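(* Let $K$ be an absolutely algebraic field with infinitely many maximal subrings (up to isomorphism). If $x$ is an indeterminate over $K$, then $K(x)$ has infinitely many maximal subrings which are subfields of $K(x)$, up to isomorphism.
   Context: All rings are commutative with $1\neq 0$; subrings and homomorphisms are unital. An absolutely algebraic field is a field which is algebraic over $\mathbb{F}_p$ for some prime number $p$. A proper subring $S$ of a ring $R$ is a maximal subring of $R$ if it is maximal with respect to inclusion among the proper subrings of $R$. ''Up to isomorphism'' means that subrings are counted up to ring isomorphism. *)

(* Defs.v *)
From mathcomp Require Import all_boot all_order all_algebra.
From mathcomp Require Import all_classical.

Set Implicit Arguments.
Unset Strict Implicit.
Unset Printing Implicit Defensive.

Import GRing.Theory.

Local Open Scope classical_set_scope.
Local Open Scope ring_scope.

Definition absolutely_algebraic (K : fieldType) : Prop :=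
  exists2 p : nat, prime p &
    exists iota : {rmorphism 'F_p -> K}, forall a : K, algebraicOver iota a.

Definition is_subring (R : comNzRingType) (S : set R) : Prop :=
  GRing.subring_closed (mem S).

Definition is_subfield (F : fieldType) (S : set F) : Prop :=
  GRing.divring_closed (mem S).

Definition is_maximal_subring (R : comNzRingType) (S : set R) : Prop :=
  [/\ is_subring S, S <> setT &
      forall T : set R, is_subring T -> T <> setT -> S `<=` T -> T = S].

(* The isomorphism is represented by a function on the ambient rings of which
   only the restriction to S matters: it is not required to be a morphism, nor
   to be injective, outside S. *)
Definition subring_iso (R R' : comNzRingType) (S : set R) (T : set R') : Prop :=
  exists f : R -> R',
    [/\ set_bij S T f, f 1 = 1,
        {in S &, {morph f : a b / a + b}} &
        {in S &, {morph f : a b / a * b}}].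

Definition iso_class (R : comNzRingType) (P : set (set R)) (S : set R) :
    set (set R) :=
  [set T | P T /\ subring_iso S T].

Definition infinitely_many_up_to_iso (R : comNzRingType) (P : set (set R)) :
    Prop :=
  infinite_set (iso_class P @` P).

(* Main.v *)
(* A maximal subring E of K is sent to E(x).  Every element of K is fixed by
   some power of Frobenius, so subrings of K are fields and any fraction in K(x)
   can be given a denominator over the prime field.  Let T be a subring
   of K(x) containing E(x), and let P in K[x] lie in T, with coefficients fixed
   by a -> a^q.  Then P(x^(q^j)) = P^(q^j) lies in T for all j, and interpolating
   at the points x^(q^j) of E(x) puts the coefficients of P in T.  Hence T is
   determined by its intersection with K, which is E or K, and E(x) is maximal.
   Conversely the elements of K(x) fixed by some power of Frobenius are the
   constants, so an isomorphism E(x) -> E'(x) restricts to E -> E'. *)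

Require Import Defs.
From HB Require Import structures.
From mathcomp Require Import all_boot all_order all_algebra finfield generic_quotient.
From mathcomp Require Import all_classical.

Set Implicit Arguments.
Unset Strict Implicit.
Unset Printing Implicit Defensive.

Import GRing.Theory.

Local Open Scope classical_set_scope.
Local Open Scope ring_scope.

Local Notation "p %:F" := (@FracField.tofrac _ p).

(** * Powers of Frobenius and interpolation *)

Lemma frobD (R : comNzRingType) p k (charRp : p \in [pchar R]) (x y : R) :
  (x + y) ^+ (p ^ k) = x ^+ (p ^ k) + y ^+ (p ^ k).
Proof.
apply: exprDn_pchar; rewrite (eq_pnat _ (pcharf_eq charRp)).
by rewrite pnatX pnat_id ?(pcharf_prime charRp).
Qed.

Lemma frob_inj (F : fieldType) p k :
  p \in [pchar F] -> injective (fun x : F => x ^+ (p ^ k)).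
Proof.
move=> charFp x y /= eq_xy; apply/eqP; rewrite -subr_eq0.
have /eqP := frobD k charFp (x - y) y.
by rewrite subrK eq_xy -subr_eq subrr eq_sym expf_eq0 => /andP[].
Qed.

Lemma frob_iter (R : pzRingType) (x : R) q n : x ^+ q = x -> x ^+ (q ^ n) = x.
Proof. by move=> xq; elim: n => [|n IHn]; rewrite ?expr1 // expnS exprM xq. Qed.

(** Newton interpolation: once the value at the first node is subtracted and X - [y 0] divided out,
    the quotient takes divided differences as values at the later nodes, so induction on the size
    applies with the shifted sequence of nodes. *)
Lemma polyOver_of_values (L : fieldType) (S : subringClosed L) (y : nat -> L)
    (P : {poly L}) :
    (forall i, y i \in S) -> injective y ->
    (forall i j, (i < j)%N -> (y j - y i)^-1 \in S) ->
  (forall i, P.[y i] \in S) -> P \is a polyOver S.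
Proof.
have [n] := ubnP (size P); elim: n => // n IHn in P y *.
rewrite ltnS => szP Sy y_inj Sy1 SP.
have /factor_theorem[Q defQ] : root (P - P.[y 0%N]%:P) (y 0%N).
  by rewrite /root !hornerE subrr.
have defP : P = Q * ('X - (y 0%N)%:P) + P.[y 0%N]%:P by rewrite -defQ subrK.
rewrite defP rpredD ?rpredM ?polyOverC ?rpredB ?polyOverX ?polyOverC //.
have [-> | Q0] := eqVneq Q 0; first exact: rpred0.
apply: (IHn _ (y \o succn)) => [|i|i j /y_inj[]|i j ij|i] //=.
- apply: leq_trans szP.
  have : size (Q * ('X - (y 0%N)%:P)) = (size Q).+1.
    by rewrite size_Mmonic ?monicXsubC // size_XsubC addn2.
  have szC : (size P.[y 0%N]%:P <= 1)%N by rewrite size_polyC leq_b1.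
  move=> szM; rewrite defP size_polyDl szM // ltnS.
  by apply: leq_trans szC _; rewrite size_poly_gt0.
- exact: Sy1.
- have -> : Q.[y i.+1] = (P.[y i.+1] - P.[y 0%N]) * (y i.+1 - y 0%N)^-1.
    rewrite {1}defP !hornerE addrK mulfK // subr_eq0.
    by apply/eqP => /y_inj.
  by rewrite rpredM ?rpredB ?Sy1.
Qed.

(** The power map is additive and leaves the coefficients unchanged, so it acts on the monomials
    alone. *)
Lemma frob_comp_Xn (R : comNzRingType) p k (P : {poly R}) :
    p \in [pchar R] -> (forall i, P`_i ^+ (p ^ k) = P`_i) ->
  P ^+ (p ^ k) = P \Po 'X^(p ^ k).
Proof.
move=> charRp fixP; have charPp : p \in [pchar {poly R}] by rewrite pchar_poly.
have p0 : (0 < p ^ k)%N by rewrite expn_gt0 (prime_gt0 (pcharf_prime charRp)).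
rewrite comp_polyE -[in LHS](coefK P) poly_def.
have pow0 : (0 : {poly R}) ^+ (p ^ k) = 0 by rewrite expr0n eqn0Ngt p0.
rewrite (big_morph (fun x => x ^+ (p ^ k)) (frobD k charPp) pow0).
apply: eq_bigr => i _.
by rewrite exprZn fixP -!exprM mulnC.
Qed.

(** * Periodic and fixed elements of Frobenius in K *)

Lemma algebraic_periodic (K : fieldType) p (p_pr : prime p)
    (iota : {rmorphism 'F_p -> K}) (a : K) :
  algebraicOver iota a -> exists2 k, (0 < k)%N & a ^+ (p ^ k) = a.
Proof.
case=> P P0 Pa.
have charKp : p \in [pchar K] by rewrite (fmorph_pchar iota) pchar_Fp.
pose r i : 'rV['F_p]_(size P) := poly_rV ('X^(p ^ i) %% P).
(* 'F_p[X]/(P) is finite, so two of the powers X^(p^i) agree modulo P. *)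
have [r_inj | ] := boolP (injectiveb (fun i : 'I_#|'rV['F_p]_(size P)|.+1 => r i)).
  by have := leq_card _ (injectiveP _ r_inj); rewrite card_ord ltnn.
have step (i j : nat) : (i < j)%N -> r i = r j ->
    exists2 k, (0 < k)%N & a ^+ (p ^ k) = a.
  move=> ij rij; exists (j - i)%N; first by rewrite subn_gt0.
  have eq_mod : 'X^(p ^ i) %% P = 'X^(p ^ j) %% P.
    by rewrite -[LHS](poly_rV_K (ltnW (ltn_modpN0 _ P0))) -/(r i) rij poly_rV_K //
       ltnW ?ltn_modpN0.
  have val n : a ^+ n = (map_poly iota ('X^n %% P)).[a].
    rewrite -[LHS](hornerXn) -(map_polyXn iota) {1}(divp_eq 'X^n P).
    by rewrite rmorphD rmorphM !hornerE (eqP Pa) mulr0 add0r.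
  (* Injectivity of the [i]-th power of Frobenius reduces the goal to a^(p^j) = a^(p^i). *)
  apply: (@frob_inj _ p i charKp) => /=.
  by rewrite -exprM -expnD subnK ?(ltnW ij) // !val eq_mod.
case/injectivePn=> i [j]; rewrite -val_eqE neq_ltn => /orP[] ij rij.
  exact: step ij rij.
exact: step ij (esym rij).
Qed.

(** Through [iota], X^p - X splits into the factors X - x with x in the prime field, and [a] is one
    of its roots. *)
Lemma frob_fixed_nat (K : fieldType) p (p_pr : prime p)
    (iota : {rmorphism 'F_p -> K}) (a : K) :
  a ^+ p = a -> exists n : nat, a = n%:R.
Proof.
move=> ap; have := congr1 (map_poly iota) (finField_genPoly 'F_p).
rewrite card_Fp // rmorphB rmorph_prod /= map_polyXn map_polyX.
move/(congr1 (horner^~ a)); rewrite !hornerE ap subrr horner_prod => /esym/eqP.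
case/prodf_eq0=> x _; rewrite map_polyXsubC !hornerE subr_eq0 => /eqP->.
by exists x; rewrite -(rmorph_nat iota) natr_Zp.
Qed.

(** * The subfield E(x) of K(x) *)

Definition ratfun (K : fieldType) (E : {pred K}) : set {fraction {poly K}} :=
  [set w | exists g h : {poly K},
     [/\ h != 0, g \is a polyOver E, h \is a polyOver E & w = g%:F / h%:F]].

Lemma fraction_quotP (R : idomainType) (w : {fraction R}) :
  exists g h : R, h != 0 /\ w = g%:F / h%:F.
Proof.
elim/quotW: w => x; exists (\n_x), (\d_x).
have d0 : \d_x != 0 := denom_ratioP x.
split=> //; apply: (canRL (mulfK _)); first by rewrite tofrac_eq0.
unlock FracField.tofrac.
rewrite -[LHS]FracField.pi_mul; apply/eqmodP.
rewrite /= FracField.equivfE /FracField.mulf !numden_Ratio ?oner_eq0 ?mulr1 //.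
by rewrite mulrC.
Qed.

Definition subring_pred (R : comNzRingType) (S : set R) (S_ring : is_subring S) :
    subringClosed R :=
  HB.pack (mem S : {pred R}) (GRing.isSubringClosed.Build R (mem S) S_ring).

Lemma ratfun_poly (K : fieldType) (E : subringClosed K) (P : {poly K}) :
  P \is a polyOver E -> ratfun E P%:F.
Proof.
move=> EP; exists P, 1; split; rewrite ?oner_eq0 ?rpred1 //.
by rewrite rmorph1 divr1.
Qed.

Lemma ratfun_subfield (K : fieldType) (E : subringClosed K) :
  is_subfield (ratfun E).
Proof.
split=> [|x y|x y].
- by rewrite inE -(rmorph1 (@FracField.tofrac {poly K})); apply/ratfun_poly/rpred1.
- rewrite !inE => -[g1 [h1 [h10 Eg1 Eh1 ->]]] [g2 [h2 [h20 Eg2 Eh2 ->]]].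
  exists (g1 * h2 - g2 * h1), (h1 * h2); split.
  + by rewrite mulf_neq0.
  + by rewrite rpredB ?rpredM.
  + by rewrite rpredM.
  + by rewrite -mulNr addf_div ?tofrac_eq0 // !rmorphM rmorphB !rmorphM mulNr.
- rewrite !inE => -[g1 [h1 [h10 Eg1 Eh1 ->]]] [g2 [h2 [h20 Eg2 Eh2 ->]]].
  (* The inverse of 0 is 0 by convention; the general formula would have the denominator [h1 * g2] =
     0. *)
  have [-> | g20] := eqVneq g2 0.
    rewrite rmorph0 mul0r invr0 mulr0 -(rmorph0 (@FracField.tofrac {poly K})).
    exact/ratfun_poly/rpred0.
  exists (g1 * h2), (h1 * g2); split; rewrite ?mulf_neq0 ?rpredM //.
  by rewrite invf_div mulf_div !rmorphM.
Qed.

(** * Frobenius acting on coefficients *)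

Lemma common_period (K : fieldType) p (P : {poly K}) : (0 < p)%N ->
    (forall a : K, exists2 k, (0 < k)%N & a ^+ (p ^ k) = a) ->
  exists2 k, (0 < k)%N & forall i, P`_i ^+ (p ^ k) = P`_i.
Proof.
move=> p0 periodic.
suff [k k0 fixP]: exists2 k, (0 < k)%N &
    forall a, a \in (P : seq K) -> a ^+ (p ^ k) = a.
  exists k => // i; have [iP | Pi] := ltnP i (size P).
    exact/fixP/mem_nth.
  by rewrite nth_default // expr0n expn_eq0 eqn0Ngt p0.
elim: (P : seq K) => [|a s [k k0 fixs]]; first by exists 1%N.
have [l l0 al] := periodic a; exists (k * l)%N; first by rewrite muln_gt0 k0.
move=> b /predU1P[-> | /fixs bk]; last by rewrite expnM; apply: frob_iter.
by rewrite mulnC expnM; apply: frob_iter.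
Qed.

(** [N] is the norm of [h], the product of its [k] Frobenius conjugates: Frobenius permutes these
    cyclically, hence fixes [N]. *)
Lemma frob_norm (K : fieldType) p k (h : {poly K}) :
    p \in [pchar K] -> (0 < k)%N -> (forall i, h`_i ^+ (p ^ k) = h`_i) ->
  h != 0 -> exists N : {poly K},
    [/\ N != 0, exists u, N = h * u & forall i, N`_i ^+ p = N`_i].
Proof.
move=> charKp k0 fixh h0; pose phi := pFrobenius_aut charKp.
have coef_iter i j : (iter i (map_poly phi) h)`_j = h`_j ^+ (p ^ i).
  elim: i => //= i IHi.
  by rewrite coef_map IHi /= pFrobenius_autE -exprM -expnSr.
exists (\prod_(i < k) iter i (map_poly phi) h); split.
- apply/prodf_neq0 => i _; elim: (i : nat) => //= j IHj.
  by rewrite map_poly_eq0.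
- case: k k0 {fixh} => // k _; rewrite big_ord_recl.
  by exists (\prod_(i < k) iter (lift ord0 i) (map_poly phi) h).
- set N := \prod_(i < k) _ => i.
  suff fixN : map_poly phi N = N.
    by rewrite -[in RHS]fixN coef_map /= pFrobenius_autE.
  rewrite {}/N rmorph_prod.
  (* Frobenius shifts the factors by one; the last becomes the conjugate by the full period, which
     is the first factor [h]. *)
  case: k k0 fixh => // k _ fixh; rewrite big_ord_recr big_ord_recl mulrC.
  congr (_ * _); apply/polyP => j.
  by have := coef_iter k.+1 j; rewrite fixh.
Qed.

(** Expanding the fraction turns its denominator into a norm, whose coefficients are integer
    multiples of 1 and so lie in every subring [E]. *)
Lemma frac_prime_denominator (K : fieldType) p (E : subringClosed K)
    (charKp : p \in [pchar K])
    (periodic : forall a : K, exists2 k, (0 < k)%N & a ^+ (p ^ k) = a)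
    (prime_field : forall a : K, a ^+ p = a -> exists n : nat, a = n%:R)
    (w : {fraction {poly K}}) :
  exists g N : {poly K}, [/\ N != 0, N \is a polyOver E & w = g%:F / N%:F].
Proof.
have [g [h [h0 ->]]] := fraction_quotP w.
have [k k0 fixh] := common_period h (prime_gt0 (pcharf_prime charKp)) periodic.
have [N [N0 [u defN] fixN]] := frob_norm charKp k0 fixh h0.
exists (g * u), N; split=> //.
  by apply/polyOverP => i; have [n ->] := prime_field _ (fixN i); apply: rpred_nat.
move: N0; rewrite defN mulf_eq0 negb_or => /andP[_ u0].
by rewrite !rmorphM -mulf_div divff ?mulr1 // tofrac_eq0.
Qed.

Lemma coef_in_overring (K : fieldType) p (E : subringClosed K)
    (charKp : p \in [pchar K])
    (periodic : forall a : K, exists2 k, (0 < k)%N & a ^+ (p ^ k) = a)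
    (T : subringClosed {fraction {poly K}}) (P : {poly K}) :
    (forall w, ratfun E w -> w \in T) -> P%:F \in T ->
  forall i, (P`_i)%:P%:F \in T.
Proof.
move=> ET TP i; have p_pr := pcharf_prime charKp.
have [k k0 fixP] := common_period P (prime_gt0 p_pr) periodic.
(* The nodes are x^(q^j) with q = p^k; they are distinct because [k] is positive. *)
pose y j : {fraction {poly K}} := ('X^(p ^ (k * j)))%:F.
have y_inj : injective y.
  move=> j1 j2 /eqP; rewrite tofrac_eq => /eqP /(congr1 (fun q : {poly K} => size q)).
  rewrite !size_polyXn => -[] /(expnI (prime_gt1 p_pr)) /eqP.
  by rewrite eqn_pmul2l // => /eqP.
have Ey j : ratfun E (y j) by apply/ratfun_poly/rpredX/polyOverX.
suff /polyOverP/(_ i) : map_poly (@FracField.tofrac {poly K}) P^:P \is a polyOver T.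
  by rewrite !coef_map.
apply: (polyOver_of_values (y := y)) => // [j|j1 j2 _|j].
- exact/ET/Ey.
- apply: ET; have [E1 EB ED] := ratfun_subfield E.
  rewrite -[_^-1]mul1r -in_setE; apply: ED => //; apply: EB; rewrite inE; exact: Ey.
(* The value at the node x^(q^j) is the power P^(q^j), which lies in [T] along with P. *)
- rewrite horner_map -/(P \Po _) -(frob_comp_Xn charKp) => [|i']; last first.
    by rewrite expnM; apply: frob_iter.
  by rewrite rmorphXn rpredX.
Qed.

(** * Constants in K(x) *)

Lemma periodic_subring_inv (K : fieldType) p (S : subringClosed K) (a : K) :
    p \in [pchar K] ->
    (forall a : K, exists2 k, (0 < k)%N & a ^+ (p ^ k) = a) ->
  a \in S -> a^-1 \in S.
Proof.
move=> charKp periodic Sa; have [k k0 ak] := periodic a.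
have [-> | a0] := eqVneq a 0; first by rewrite invr0 rpred0.
have p1 : (1 < p ^ k)%N.
  by rewrite -(expn0 p) ltn_exp2l // prime_gt1 ?(pcharf_prime charKp).
(* Since [a] is nonzero, a^q = a gives a^(q-1) = 1 with q = p^k; [p1] makes the subtraction
   exact. *)
suff -> : a^-1 = a ^+ (p ^ k - 2) by rewrite rpredX.
apply: (mulfI a0); rewrite divff // -exprS -[X in a ^+ X]subSn // subSS.
apply: (mulfI a0); rewrite -exprS mulr1 -[X in a ^+ X]subSn ?subSS ?subn0 ?ak //.
exact: ltnW.
Qed.

(** In c h = g, the coefficients at the degree of h express c as a quotient of elements of [E], and
    [E] is closed under inverses. *)
Lemma ratfun_const (K : fieldType) p (E : subringClosed K) (c : K) :
    p \in [pchar K] ->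
    (forall a : K, exists2 k, (0 < k)%N & a ^+ (p ^ k) = a) ->
  ratfun E c%:P%:F -> c \in E.
Proof.
move=> charKp periodic [g [h [h0 /polyOverP Eg /polyOverP Eh]]].
move/(congr1 ( *%R^~ h%:F))/eqP; rewrite /= divfK ?tofrac_eq0 //.
rewrite -rmorphM tofrac_eq => /eqP/(congr1 (coefp (size h).-1)) /=.
rewrite coefCM -lead_coefE => /(congr1 ( *%R^~ (lead_coef h)^-1)).
rewrite mulfK ?lead_coef_eq0 // => ->.
apply: rpredM; first exact: Eg.
exact: (periodic_subring_inv charKp periodic (Eh _)).
Qed.

Lemma frac_frob_fixed (K : fieldType) p k (w : {fraction {poly K}}) :
    p \in [pchar K] -> (0 < k)%N -> w ^+ (p ^ k) = w ->
  exists c : K, w = c%:P%:F.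
Proof.
move=> charKp k0 wq; have p_pr := pcharf_prime charKp.
have q1 : (1 < p ^ k)%N by rewrite -(expn0 p) ltn_exp2l // prime_gt1.
have charLp : p \in [pchar {fraction {poly K}}].
  apply: (rmorph_pchar (@FracField.tofrac {poly K})).
  exact: (rmorph_pchar (@polyC K)).
(* If w = g / h is nonzero and fixed, then g and h have the same degree; applied
   to w - c, where c is the quotient of the leading coefficients, this forces
   w = c. *)
have root1 (g h : {poly K}) : g != 0 -> h != 0 ->
    (g%:F / h%:F) ^+ (p ^ k) = g%:F / h%:F ->
    size g = size h /\ lead_coef g ^+ (p ^ k).-1 = lead_coef h ^+ (p ^ k).-1.
  move=> g0 h0; have w0 : g%:F / h%:F != 0.
    by rewrite mulf_neq0 ?invr_eq0 ?tofrac_eq0.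
  (* Cancelling one factor g/h leaves g^(q-1) = h^(q-1) with q - 1 positive, which yields both
     conclusions. *)
  rewrite -[in LHS](prednK (ltnW q1)) exprS -[RHS]mulr1 => /(mulfI w0)/eqP.
  rewrite expr_div_n -!rmorphXn -(inj_eq (mulIf _ : injective ( *%R^~ (h ^+ (p ^ k).-1)%:F))).
    rewrite divfK ?mul1r ?tofrac_eq ?tofrac_eq0 ?expf_neq0 // => /eqP eq_gh.
    split; last by rewrite -!lead_coef_exp eq_gh.
    have := congr1 (fun P : {poly K} => (size P).-1) eq_gh; rewrite !size_exp.
    move/eqP; rewrite eqn_pmul2r; last by rewrite -subn1 subn_gt0.
    by move/eqP => eq_sz; rewrite (polySpred g0) eq_sz -(polySpred h0).
  by rewrite tofrac_eq0 expf_neq0.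
have [g [h [h0 defw]]] := fraction_quotP w.
have [g0 | g0] := eqVneq g 0; first by exists 0; rewrite defw g0 !rmorph0 mul0r.
rewrite defw in wq *; have [sz_gh lead_gh] := root1 _ _ g0 h0 wq.
have lh0 : lead_coef h != 0 by rewrite lead_coef_eq0.
pose c := lead_coef g / lead_coef h; exists c.
have cq : c ^+ (p ^ k) = c.
  rewrite -(prednK (ltnW q1)) exprS expr_div_n lead_gh divff ?mulr1 //.
  exact: expf_neq0.
apply/eqP; rewrite -subr_eq0.
have defd : g%:F / h%:F - c%:P%:F = (g - c *: h)%:F / h%:F.
  by rewrite -mul_polyC tofracB tofracM mulrBl mulfK // tofrac_eq0.
rewrite defd.
have [-> | d0] := eqVneq (g - c *: h) 0; first by rewrite rmorph0 mul0r.
have [|sz_d _] := root1 _ _ d0 h0.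
  apply/eqP; rewrite -defd -(inj_eq (addIr (c%:P%:F))) subrK.
  have cFq : c%:P%:F ^+ (p ^ k) = c%:P%:F :> {fraction {poly K}}.
    by rewrite -!rmorphXn cq.
  by rewrite -{2}cFq -frobD // subrK wq.
(* The difference has the size of [h], yet [c] was chosen to cancel its coefficient at that
   degree. *)
have : lead_coef (g - c *: h) == 0.
  rewrite lead_coefE sz_d coefB coefZ -lead_coefE -sz_gh -lead_coefE.
  by rewrite divfK // subrr.
by rewrite lead_coef_eq0 (negPf d0).
Qed.

(** * Maximality of E(x) *)

Lemma ratfun_maximal (K : fieldType) p (E : set K)
    (charKp : p \in [pchar K])
    (periodic : forall a : K, exists2 k, (0 < k)%N & a ^+ (p ^ k) = a)
    (prime_field : forall a : K, a ^+ p = a -> exists n : nat, a = n%:R) :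
  is_maximal_subring E -> is_maximal_subring (ratfun (mem E)).
Proof.
case=> E_ring EnT Emax; pose E' := subring_pred E_ring.
split=> [|eqT|T T_ring TnT ET].
- exact/GRing.divring_closedBM/(ratfun_subfield E').
- case: EnT; rewrite -subTset => c _.
  rewrite -in_setE; apply: (@ratfun_const _ p E') => //.
  by rewrite [ratfun _]eqT.
pose T' := subring_pred T_ring.
have ET' w : ratfun E' w -> w \in T' by move=> /ET; rewrite -in_setE.
pose T0 : set K := [set c | c%:P%:F \in T'].
have T0_ring : is_subring T0.
  split=> [|a b /set_mem Ta /set_mem Tb|a b /set_mem Ta /set_mem Tb].
  - by apply: mem_set; rewrite /T0 /mkset !rmorph1 rpred1.
  - by apply: mem_set; rewrite /T0 /mkset !rmorphB rpredB.
  - by apply: mem_set; rewrite /T0 /mkset !rmorphM rpredM.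
(* If [T] contains K, it contains K[x] and the inverses of nonzero polynomials over [E], hence all
   of K(x). *)
have [T0T | T0nT] := pselect (T0 = setT).
  case: TnT; rewrite -subTset => w _.
  have [g [N [N0 EN ->]]] := frac_prime_denominator E' charKp periodic prime_field w.
  rewrite -in_setE; apply: (rpredM (s := T')); last first.
    apply: ET'; have [E1 _ ED] := ratfun_subfield E'.
    rewrite -[_^-1]mul1r -in_setE; apply: ED => //.
    by rewrite inE; apply: ratfun_poly.
  rewrite -[g]coefK poly_def rmorph_sum rpred_sum // => i _.
  rewrite -mul_polyC rmorphM rpredM //.
    by have : T0 g`_i by rewrite T0T.
  apply: ET'; apply: ratfun_poly; exact/rpredX/polyOverX.
have T0E : T0 = E.
  apply: Emax => // c Ec; apply: ET'; apply: ratfun_poly.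
  by rewrite polyOverC; apply/mem_set.
apply/seteqP; split=> // w Tw.
have [g [N [N0 EN defw]]] := frac_prime_denominator E' charKp periodic prime_field w.
exists g, N; split=> //; apply/(polyOverP (S := E')) => i.
(* The numerator g = w N lies in [T], so its coefficients lie in the intersection of [T] with K,
   which is [E]. *)
suff : T0 g`_i by rewrite T0E; apply: mem_set.
apply: (coef_in_overring (E := E') charKp periodic ET').
have -> : g%:F = w * N%:F by rewrite defw divfK // tofrac_eq0.
apply: (rpredM (s := T')); first exact: mem_set.
by apply: ET'; apply: ratfun_poly.
Qed.

(** * Isomorphisms of subrings *)

Lemma subring_iso_sym (R R' : comNzRingType) (S : set R) (T : set R') :
  is_subring S -> subring_iso S T -> subring_iso T S.
Proof.
move=> S_ring [f [[fun_f inj_f surj_f] f1 fD fM]]; pose S' := subring_pred S_ring.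
(* The default 0 is only taken outside [T], where the values of [g] are irrelevant. *)
pose g y := xget 0 [set x | S x /\ f x = y].
have gP y : T y -> S (g y) /\ f (g y) = y.
  by move=> /surj_f[x Sx fx]; rewrite /g; case: xgetP => [_ _ // | /(_ x)[]].
have gK x : S x -> g (f x) = x.
  move=> Sx; have [Sg eq_f] := gP _ (fun_f _ Sx).
  by apply: inj_f; rewrite ?in_setE.
have S1 : S 1 by rewrite -in_setE; apply: (rpred1 S').
exists g; split=> [||a b|a b].
- split=> [y /gP[] // | a b | x Sx].
    by rewrite !in_setE => /gP[_ {2}<-] /gP[_ {2}<-] ->.
  by exists (f x); [exact: fun_f | exact: gK].
- by rewrite -f1 gK.
- rewrite !in_setE => /gP[Sa {1}<-] /gP[Sb {1}<-].
  rewrite -fD ?in_setE // gK //; rewrite -in_setE.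
  by apply: (rpredD (S := S')); apply: mem_set.
- rewrite !in_setE => /gP[Sa {1}<-] /gP[Sb {1}<-].
  rewrite -fM ?in_setE // gK //; rewrite -in_setE.
  by apply: (rpredM (s := S')); apply: mem_set.
Qed.

Lemma subring_iso_trans (R1 R2 R3 : comNzRingType)
    (S1 : set R1) (S2 : set R2) (S3 : set R3) :
  subring_iso S1 S2 -> subring_iso S2 S3 -> subring_iso S1 S3.
Proof.
move=> [f [bij_f f1 fD fM]] [g [bij_g g1 gD gM]]; exists (g \o f).
have [fun_f _ _] := bij_f.
split=> [|/=|a b|a b] /=; first exact: set_bij_comp bij_f bij_g.
- by rewrite f1.
- by move=> Sa Sb; rewrite fD // gD // in_setE; apply: fun_f; rewrite -in_setE.
- by move=> Sa Sb; rewrite fM // gM // in_setE; apply: fun_f; rewrite -in_setE.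
Qed.

Lemma subring_iso_refl (R : comNzRingType) (S : set R) : subring_iso S S.
Proof. by exists id; split=> //; split=> // x Sx; exists x. Qed.

Lemma subring_iso_exp (R R' : comNzRingType) (S : subringClosed R) (f : R -> R') n :
    f 1 = 1 -> {in S &, {morph f : a b / a * b}} ->
  {in S, {morph f : a / a ^+ n}}.
Proof.
move=> f1 fM a Sa; elim: n => [|n IHn]; first by rewrite !expr0.
by rewrite !exprS fM ?rpredX // IHn.
Qed.

(** An isomorphism commutes with powers, so it carries elements fixed by a power of Frobenius, that
    is constants, to constants. *)
Lemma iso_of_ratfun (K : fieldType) p (E1 E2 : set K)
    (charKp : p \in [pchar K])
    (periodic : forall a : K, exists2 k, (0 < k)%N & a ^+ (p ^ k) = a) :
    is_subring E1 -> is_subring E2 ->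
    subring_iso (ratfun (mem E1)) (ratfun (mem E2)) ->
  subring_iso E1 E2.
Proof.
move=> E1_ring E2_ring [f [[fun_f inj_f surj_f] f1 fD fM]].
pose E1' := subring_pred E1_ring; pose E2' := subring_pred E2_ring.
pose L1 := subring_pred (GRing.divring_closedBM (ratfun_subfield E1')).
have fX n : {in L1, {morph f : a / a ^+ n}} by apply: subring_iso_exp.
pose iota (c : K) : {fraction {poly K}} := c%:P%:F.
have iota_inj : injective iota.
  by move=> a b /eqP; rewrite tofrac_eq => /eqP/polyC_inj.
have iotaD : {morph iota : a b / a + b} by move=> a b; rewrite /iota !rmorphD.
have iotaM : {morph iota : a b / a * b} by move=> a b; rewrite /iota !rmorphM.
have ratE1 c : E1 c -> iota c \in L1.
  move=> Ec; apply/mem_set/(ratfun_poly (E := E1')).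
  by rewrite polyOverC; apply: mem_set.
have ratE2 c : E2 c -> ratfun (mem E2) (iota c).
  by move=> Ec; apply/(ratfun_poly (E := E2')); rewrite polyOverC; apply: mem_set.
pose g c := xget 0 [set d | iota d = f (iota c)].
have gP c : E1 c -> E2 (g c) /\ iota (g c) = f (iota c).
  move=> Ec; have Lc := ratE1 c Ec; have [k k0 ck] := periodic c.
  have [|d fd] := @frac_frob_fixed _ p k (f (iota c)) charKp k0.
    by rewrite -fX // -!rmorphXn ck.
  have gd : iota (g c) = f (iota c).
    by rewrite /g; case: xgetP => [x _ // | /(_ d)[]]; rewrite /= fd.
  split=> //; rewrite -in_setE; apply: (ratfun_const (E := E2') charKp periodic).
  by rewrite -/(iota _) gd; apply: fun_f; rewrite -in_setE.
exists g; split.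
- split=> [c /gP[] // | a b | d E2d].
    rewrite !in_setE => Ea Eb eq_g; apply: iota_inj; apply: inj_f; try exact: ratE1.
    by have [_ <-] := gP a Ea; have [_ <-] := gP b Eb; rewrite eq_g.
  (* Surjectivity: by injectivity of [f], the preimage of a constant is fixed by the same power of
     Frobenius, hence constant. *)
  have [w E1w fw] := surj_f _ (ratE2 d E2d).
  have Lw : w \in L1 by apply: mem_set.
  have [k k0 dk] := periodic d.
  have [|c wc] := @frac_frob_fixed _ p k w charKp k0.
    apply: inj_f => //; first exact: (rpredX _ Lw).
    by rewrite fX // fw -/(iota d) -!rmorphXn dk.
  have E1c : E1 c.
    rewrite -in_setE; apply: (ratfun_const (E := E1') charKp periodic).
    by rewrite -wc.
  exists c => //; apply: iota_inj; have [_ ->] := gP c E1c.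
  by rewrite /iota -wc.
- have E11 : E1 1 by rewrite -in_setE; apply: (rpred1 E1').
  by apply: iota_inj; have [_ ->] := gP 1 E11; rewrite /iota !rmorph1.
- move=> a b /set_mem Ea /set_mem Eb; apply: iota_inj.
  have Eab : E1 (a + b).
    by rewrite -in_setE; apply: (rpredD (S := E1')); apply: mem_set.
  have [_ ->] := gP _ Eab; rewrite !iotaD fD ?ratE1 //.
  by have [_ ->] := gP a Ea; have [_ ->] := gP b Eb.
- move=> a b /set_mem Ea /set_mem Eb; apply: iota_inj.
  have Eab : E1 (a * b).
    by rewrite -in_setE; apply: (rpredM (s := E1')); apply: mem_set.
  have [_ ->] := gP _ Eab; rewrite !iotaM fM ?ratE1 //.
  by have [_ ->] := gP a Ea; have [_ ->] := gP b Eb.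
Qed.

(** * Counting isomorphism classes *)

Theorem proposition3p6 (K : fieldType)
    (K_alg : absolutely_algebraic K)
    (K_inf : infinitely_many_up_to_iso
               [set S : set K | is_maximal_subring S]) :
  infinitely_many_up_to_iso
    [set S : set {fraction {poly K}} | is_maximal_subring S /\ is_subfield S].
Proof.
have [p p_pr [iota iota_alg]] := K_alg.
have charKp : p \in [pchar K] by rewrite (fmorph_pchar iota) pchar_Fp.
have periodic a := algebraic_periodic p_pr (iota_alg a).
have prime_field := frob_fixed_nat p_pr iota.
move: K_inf; rewrite /infinitely_many_up_to_iso.
set P := [set S : set K | _]; set P' := [set S : set {fraction _} | _].
have PP' E : P E -> P' (ratfun (mem E)).
  move=> PE; split; first exact: ratfun_maximal periodic prime_field PE.
  by have [E_ring _ _] := PE; exact: (ratfun_subfield (subring_pred E_ring)).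
apply: contra_not => fin.
(* [G] recovers the class of E from the class of E(x) by choosing any maximal subring E1 with E1(x)
   in that class; E1 is then isomorphic to E. Finitely many classes in K(x) would thus leave
   finitely many in K. *)
pose G (C : set (set {fraction {poly K}})) : set (set K) :=
  iso_class P (xget set0 [set E | P E /\ C (ratfun (mem E))]).
apply: sub_finite_set (finite_image G fin) => _ [E PE <-].
exists (iso_class P' (ratfun (mem E))); first by exists (ratfun (mem E)); [exact: PP'|].
rewrite /G; case: xgetP => [E1 _ [PE1 [_ isoE1]] | /(_ E)[]]; last first.
  by split=> //; split; [apply: PP' | apply: subring_iso_refl].
have [E_ring _ _] := PE; have [E1_ring _ _] := PE1.
have isoEE1 := iso_of_ratfun charKp periodic E_ring E1_ring isoE1.
have isoE1E := subring_iso_sym E_ring isoEE1.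
apply/seteqP; split=> T [PT isoT]; split=> //.
  exact: subring_iso_trans isoEE1 isoT.
exact: subring_iso_trans isoE1E isoT.
Qed.
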